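(* Let $G$ be a group, let $S$ be a finite transitive right $G$-set, let $F$ be an arbitrary field, and let $0 \ne v \in F[S]$. Then $$|\mathrm{supp}(v)| \cdot \dim_F(\langle v\rangle) \ge |S|,$$ where $\langle v\rangle$ is the $G$-submodule of $F[S]$ generated by $v$.
   Context: For a field $F$ and a right $G$-set $S$, $F[S]$ denotes the permutation module: the $F$-vector space of (finite) formal $F$-linear combinations of elements of $S$, with the right action of $G$ on $S$ extended linearly to $F[S]$. For $v\in F[S]$, $\mathrm{supp}(v)$ is the set of points of $S$ that occur with nonzero coefficient in $v$, and $\langle v\rangle$ is the $G$-submodule of $F[S]$ generated by $v$, i.e. the $F$-linear span of the translates $vg$, $g\in G$. Transitive $G$-sets are nonempty. *)

(* Defs.v *)
From HB Require Import structures.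
From mathcomp Require Import all_boot all_algebra.
From mathcomp Require Import boolp.

Set Implicit Arguments.
Unset Strict Implicit.
Unset Printing Implicit Defensive.

Import GRing.Theory.
Local Open Scope ring_scope.

(** The group [G] may be infinite, so the finite-group actions of
    [fingroup/action.v] do not apply. *)

Record rightAction (G : groupType) (S : Type) := RightAction {
  ract_fun :> S -> G -> S;
  ract1 : forall s, ract_fun s 1%g = s;
  ractM : forall s g h, ract_fun s (g * h)%g = ract_fun (ract_fun s g) h }.

Definition transitive_action (G : groupType) (S : Type)
    (act : rightAction G S) : Prop :=
  inhabited S /\ forall s t : S, exists g : G, act s g = t.

(** [F[S]] for finite [S].  The codomain is [F^o] because the library puts a
    vector space structure on [{ffun S -> V}] for [V] a vector space. *)
Notation permmod F S := {ffun S -> F^o}.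

Definition pt (F : fieldType) (S : finType) (s : S) : permmod F S :=
  [ffun t => (t == s)%:R].

Definition translate (G : groupType) (S : finType) (act : rightAction G S)
    (F : fieldType) (v : permmod F S) (g : G) : permmod F S :=
  \sum_(s : S) v s *: pt F (act s g).

(** The library's [span] takes a finite sequence; here the index type [I] of the
    family is arbitrary. *)
Definition is_family_span (F : fieldType) (V : vectType F) (I : Type)
    (x : I -> V) (U : {vspace V}) : Prop :=
  forall w : V, w \in U <->
    exists l : seq (F * I), w = \sum_(p <- l) p.1 *: x p.2.

Lemma family_span_exists (F : fieldType) (V : vectType F) (I : Type)
    (x : I -> V) : exists U : {vspace V}, is_family_span x U.
Proof.
pose P n := `[< exists t : seq I, \dim <<map x t>> = n >].
have exP : exists n, P n by exists (\dim <<map x [::]>>); apply/asboolP; exists [::].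
have leP n : P n -> (n <= \dim {:V})%N.
  by move=> /asboolP[t <-]; apply/dimvS/subvf.
case: (ex_maxnP exP leP) => n /asboolP[t tn] maxn.
have xt i : x i \in <<map x t>>%VS.
  have le : (<<map x t>> <= <<map x (i :: t)>>)%VS.
    by rewrite /= span_cons addvSr.
  have : <<map x t>>%VS == <<map x (i :: t)>>%VS.
    rewrite eqEdim le tn /=; apply: maxn; apply/asboolP; by exists (i :: t).
  by move/eqP=> ->; rewrite memv_span //= mem_head.
exists <<map x t>>%VS => w; split=> [|[l ->]]; last first.
  by apply: rpred_sum => p _; apply: rpredZ.
elim: t {tn maxn xt} w => [|i t IH] w /=.
  by rewrite span_nil memv0 => /eqP ->; exists [::]; rewrite big_nil.
rewrite span_cons => /memv_addP[_ /vlineP[c ->]] [u /IH[l ->] ->].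
by exists ((c, i) :: l); rewrite big_cons.
Qed.

Definition family_span (F : fieldType) (V : vectType F) (I : Type)
    (x : I -> V) : {vspace V} :=
  projT1 (cid (family_span_exists x)).

Lemma family_spanP (F : fieldType) (V : vectType F) (I : Type) (x : I -> V) :
  is_family_span x (family_span x).
Proof. exact: projT2 (cid (family_span_exists x)). Qed.

Definition gen_submod (G : groupType) (S : finType) (act : rightAction G S)
    (F : fieldType) (v : permmod F S) : {vspace permmod F S} :=
  family_span (translate act v).

Section Sanity.

Variables (G : groupType) (S : finType) (act : rightAction G S) (F : fieldType).
Implicit Types (v w : permmod F S) (g h : G) (U : {vspace permmod F S}).

Lemma ractK g : cancel (act ^~ g) (act ^~ g^-1%g).
Proof. by move=> s; rewrite -ractM mulgV ract1. Qed.

Lemma translateE v g t : translate act v g t = v (act t g^-1%g).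
Proof.
rewrite /translate sum_ffunE (bigD1 (act t g^-1%g)) //= big1 => [|s ns].
  by rewrite !ffunE -ractM mulVg ract1 eqxx addr0 /GRing.scale /= mulr1.
rewrite !ffunE; case: eqP => [e|_]; last by rewrite scaler0.
by case/eqP: ns; rewrite e ractK.
Qed.

Lemma translate1 v : translate act v 1%g = v.
Proof. by apply/ffunP=> t; rewrite translateE invg1 ract1. Qed.

Lemma translateM v g h :
  translate act v (g * h)%g = translate act (translate act v g) h.
Proof. by apply/ffunP=> t; rewrite !translateE invgM ractM. Qed.

Lemma translate_sum (I : Type) (l : seq I) (c : I -> F) (x : I -> permmod F S) g :
  translate act (\sum_(i <- l) c i *: x i) g
    = \sum_(i <- l) c i *: translate act (x i) g.
Proof.
apply/ffunP=> t; rewrite translateE !sum_ffunE; apply: eq_bigr => i _.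
by rewrite !ffunE translateE.
Qed.

Lemma gen_submod_id v : v \in gen_submod act v.
Proof.
apply/family_spanP; exists [:: (1, 1%g)].
by rewrite big_seq1 scale1r translate1.
Qed.

Lemma gen_submod_stable v w g :
  w \in gen_submod act v -> translate act w g \in gen_submod act v.
Proof.
move/family_spanP=> [l ->]; apply/family_spanP.
exists [seq (p.1, (p.2 * g)%g) | p <- l].
rewrite big_map translate_sum; apply: eq_bigr => p _.
by rewrite translateM.
Qed.

Lemma gen_submod_min v U :
  v \in U -> (forall w g, w \in U -> translate act w g \in U) ->
  (gen_submod act v <= U)%VS.
Proof.
move=> vU stU; apply/subvP=> w /family_spanP[l ->].
by apply: rpred_sum => p _; apply/rpredZ/stU.
Qed.

End Sanity.

(* Main.v *)
(** If a translate of [v] is nonzero at a point where all the previously chosen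
    ones vanish, then it is not in their span.  Hence the union of the supports
    of a family of translates has at most [|supp v|] points per dimension of
    their span; by transitivity the supports of all translates cover [S]. *)
Require Import Defs.
From mathcomp Require Import all_boot all_algebra.
From mathcomp Require Import boolp.
Import GRing.Theory.
Local Open Scope ring_scope.

Lemma span_ffun_eq0 (F : fieldType) (S : finType) (X : seq (permmod F S))
    (w : permmod F S) (s : S) :
  (forall x, x \in X -> x s = 0) -> w \in <<X>>%VS -> w s = 0.
Proof.
move=> Xs0 /(coord_span (X := in_tuple X)) ->.
rewrite sum_ffunE big1 // => i _.
by rewrite ffunE Xs0 ?scaler0 // mem_nth.
Qed.

Lemma card_cover_support (F : fieldType) (S : finType) (k : nat)
    (X : seq (permmod F S)) :
  (forall x, x \in X -> (#|support x| <= k)%N) ->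
  (#|[set s | has (fun x : permmod F S => x s != 0%R) X]| <= k * \dim <<X>>)%N.
Proof.
elim: X => [|x X IH] leXk.
  by rewrite (_ : finset _ = set0) ?cards0 //; apply/setP => s; rewrite !inE.
have {}IH := IH (fun y Xy => leXk y (mem_behead (s := x :: X) Xy)).
(* If [x] lies in the span, it vanishes wherever all of [X] does, so neither the dimension nor the
   union of supports changes. Otherwise the dimension grows by one, which pays for the at most [k]
   new points. *)
have [xX|xNX] := boolP (x \in <<X>>%VS).
  have -> : <<x :: X>>%VS = <<X>>%VS by rewrite span_cons; apply/addv_idPr.
  apply: leq_trans IH; apply/subset_leq_card/subsetP => s; rewrite !inE /=.
  case/orP=> // xs; apply: contraNT xs => /hasPn Xs0.
  apply/eqP; apply: (span_ffun_eq0 _ _ X) xX => y /Xs0.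
  by rewrite negbK => /eqP.
have -> : \dim <<x :: X>> = (\dim <<X>>).+1.
  rewrite span_cons dimv_disjoint_sum.
    rewrite dim_vline (_ : x != 0) //.
    by apply: contraNneq xNX => ->; apply: mem0v.
  (* A multiple [c *: x] in the span with [c] nonzero would put [x] itself there. *)
  apply/eqP; rewrite -subv0; apply/subvP => w.
  rewrite memv_cap => /andP[/vlineP[c ->] cX].
  have [->|c0] := eqVneq c 0; first by rewrite scale0r mem0v.
  by case/negP: xNX; move: cX; rewrite (rpredZeq _ c x) (negPf c0).
rewrite mulnS; apply: leq_trans (leq_add (leXk x (mem_head _ _)) IH).
rewrite -[X in (_ <= X + _)%N]cardsE; apply: leq_trans (leq_card_setU _ _).
by apply/subset_leq_card/subsetP => s; rewrite !inE.
Qed.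

Lemma card_support_translate (G : groupType) (S : finType)
    (act : rightAction G S) (F : fieldType) (v : permmod F S) (g : G) :
  (#|support (translate act v g)| <= #|support v|)%N.
Proof.
(* Acting by [g^-1] maps the support of the translate injectively into that of [v]. *)
rewrite -(card_in_image (f := fun s => act s g^-1%g)); last first.
  by move=> s t _ _; apply: can_inj (ractK act g^-1%g) s t.
apply/subset_leq_card/subsetP => _ /imageP[s sv ->].
by move: sv; rewrite !inE translateE.
Qed.

Theorem theoremB (G : groupType) (S : finType) (act : rightAction G S)
    (act_trans : transitive_action act) (F : fieldType) (v : permmod F S)
    (v_neq0 : v != 0) :
  (#|support v| * \dim (gen_submod act v) >= #|S|)%N.
Proof.
have [s0 vs0] : exists s0, v s0 != 0.
  apply/existsP; apply: contraNT v_neq0 => /existsPn v0.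
  by apply/eqP/ffunP => s; rewrite ffunE; apply/eqP/negPn/v0.
(* Since [g s] carries [s0] to [s], the translate of [v] by [g s] takes the nonzero value [v s0] at
   [s]. One such translate per point gives a finite family even if [G] is infinite. *)
have [g gE] := choice (act_trans.2 s0).
pose X := [seq translate act v (g s) | s <- enum S].
have leXk x : x \in X -> (#|support x| <= #|support v|)%N.
  by case/mapP=> s _ ->; apply: card_support_translate.
have leX : (\dim <<X>> <= \dim (gen_submod act v))%N.
  apply/dimvS/span_subvP => _ /mapP[s _ ->].
  exact/gen_submod_stable/gen_submod_id.
apply: leq_trans (leq_mul (leqnn _) leX).
apply: leq_trans (card_cover_support _ _ _ _ leXk).
apply/subset_leq_card/subsetP => s _; rewrite inE; apply/hasP.
exists (translate act v (g s)); first by apply/mapP; exists s; rewrite ?mem_enum.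
by rewrite translateE -{1}(gE s) ractK.
Qed.
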